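(* Let $\gamma(z)=\sum_{n=1}^{\infty} z^{n-1}\left(\frac{1}{n}-\log\frac{n+1}{n}\right)$ for $|z|\le 1$. If $|z|\le 1$, then $$\gamma(z)=\int_0^1\int_0^1\frac{1-x}{(1-xyz)(-\log xy)}\,dx\,dy=\int_0^1\frac{1-x+\log x}{(1-xz)\log x}\,dx.$$ Both integrals converge for all $z\in\mathbb{C}\setminus(1,\infty)$, and they provide the analytic continuation of $\gamma(z)$ to $z\in\mathbb{C}\setminus[1,\infty)$.
   Context: Here $\log$ denotes the natural logarithm (for $z\ne0$, the principal branch $\log z=\ln|z|+i\,\mathrm{Arg}\,z$, $-\pi<\mathrm{Arg}\,z\le\pi$). *)

(* Defs.v *)
From Stdlib Require Import Reals.
From Coquelicot Require Export Coquelicot.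
Open Scope R_scope.

(* coefficient 1/n - log((n+1)/n) of z^(n-1), reindexed with k = n-1 >= 0 *)
Definition gamma_coef (k : nat) : R :=
  / INR (S k) - ln (INR (S (S k)) / INR (S k)).

Definition gamma_term (z : C) (k : nat) : C :=
  Cmult (pow_n z k) (RtoC (gamma_coef k)).

Definition integrand_single (z : C) (x : R) : C :=
  Cdiv (RtoC (1 - x + ln x)) (Cmult (Cminus (RtoC 1) (Cmult (RtoC x) z)) (RtoC (ln x))).

Definition integrand_double (z : C) (x y : R) : C :=
  Cdiv (RtoC (1 - x))
       (Cmult (Cminus (RtoC 1) (Cmult (RtoC (x * y)) z)) (RtoC (- ln (x * y)))).

Definition is_int01 (f : R -> C) (v : C) : Prop :=
  is_RInt_gen (V := C_R_NormedModule) f (at_right 0) (at_left 1) v.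

Definition is_int01_double (f : R -> R -> C) (v : C) : Prop :=
  exists inner : R -> C,
    (forall y, 0 < y < 1 -> is_int01 (fun x => f x y) (inner y)) /\
    is_int01 inner v.

Definition on_open_ray (z : C) : Prop := Im z = 0 /\ 1 < Re z.
Definition on_closed_ray (z : C) : Prop := Im z = 0 /\ 1 <= Re z.

Definition C_differentiable (F : C -> C) (z : C) : Prop :=
  ex_derive (K := C_AbsRing) (V := C_NormedModule) F z.

(* Main.v *)
(** Put [g x = 1 / ln x + 1 / (1 - x)], which extends continuously to [[0, 1]] with values in
    [[0, 1]]. The function is [F z = int_0^1 g x * (1 - x) / (1 - x z) dx], the single integral.

    Series: [int_0^1 g x * (1 - x) * x^k dx] is the coefficient [1/(k+1) - ln ((k+2)/(k+1))],
    since [li (x^(k+1)) - li (x^(k+2))] is a primitive of [x^k * (1 - x) / ln x]; the remainder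
    after [n] terms is at most [int_0^1 x^n dx] because [|1 - x z| >= 1 - x] on the unit disc.

    Double integral: with [k u = 1 / ((1 - u z) * (- ln u))] and [u = x y], the inner integral is
    [int_0^y (y - u) / y^2 * k u du], the derivative of
    [y |-> int_0^y (ln (y / u) + u / y - 1) * k u du], which goes from [0] to [F z]. No exchange
    of integrals is needed. Real and imaginary parts are treated separately.

    Analyticity: [F w - F z - (w - z) F' z] is bounded by a multiple of [|w - z|^2], with [F']
    obtained by differentiating under the integral. *)
Require Import Defs.
From Stdlib Require Import Reals Lra Lia.
From Coquelicot Require Import Coquelicot.
Open Scope R_scope.

(** * Improper integrals over (0, 1) *)

Lemma at_right_interval (a b : R) : a < b -> at_right a (fun x => a < x < b).
Proof.
  intros Hab.
  exists (mkposreal (b - a) ltac:(lra)); intros x Hx Hax.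
  apply Rabs_def2 in Hx; unfold minus, plus, opp in Hx; simpl in Hx; lra.
Qed.

Lemma at_left_interval (a b : R) : a < b -> at_left b (fun x => a < x < b).
Proof.
  intros Hab.
  exists (mkposreal (b - a) ltac:(lra)); intros x Hx Hax.
  apply Rabs_def2 in Hx; unfold minus, plus, opp in Hx; simpl in Hx; lra.
Qed.

Lemma filterlim_at_right_continuous (f : R -> R) (a : R) :
  continuous f a -> filterlim f (at_right a) (locally (f a)).
Proof.
  intros Hf; apply filterlim_filter_le_1 with (2 := Hf), filter_le_within.
Qed.

Lemma filterlim_at_left_continuous (f : R -> R) (a : R) :
  continuous f a -> filterlim f (at_left a) (locally (f a)).
Proof.
  intros Hf; apply filterlim_filter_le_1 with (2 := Hf), filter_le_within.
Qed.

Lemma filterlim_of_error {T : Type} (F : (T -> Prop) -> Prop) {FF : Filter F}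
    (f e : T -> R) (l : R) :
  F (fun t => Rabs (f t - l) <= e t) -> filterlim e F (locally 0) ->
  filterlim f F (locally l).
Proof.
  intros Hfe He; apply filterlim_locally; intros eps.
  apply (proj1 (filterlim_locally _ _)) with (eps := eps) in He.
  generalize (filter_and _ _ Hfe He); apply filter_imp; intros t [H1 H2].
  apply Rabs_def2 in H2; unfold minus, plus, opp in H2; simpl in H2.
  apply Rle_lt_trans with (1 := H1); lra.
Qed.

Lemma continuous_of_sided (f : R -> R) (a : R) :
  filterlim f (at_left a) (locally (f a)) ->
  filterlim f (at_right a) (locally (f a)) -> continuous f a.
Proof.
  intros Hl Hr; apply filterlim_locally; intros eps.
  apply (proj1 (filterlim_locally _ _)) with (eps := eps) in Hl.
  apply (proj1 (filterlim_locally _ _)) with (eps := eps) in Hr.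
  unfold at_left, at_right, within in Hl, Hr.
  generalize (filter_and _ _ Hl Hr); apply filter_imp; intros x [H1 H2].
  destruct (Rtotal_order x a) as [H | [H | H]]; auto.
  rewrite H; apply ball_center.
Qed.

(** The fundamental theorem holds on each compact [[a, b]] inside [(0, 1)]; the two endpoints then
    move independently. Nothing is asked of [H] at [0] and [1] beyond one-sided limits, so
    primitives with removable singularities there can be used. *)
Lemma is_RInt_gen_01_antiderivative (f H : R -> R) (l0 l1 : R) :
  (forall x, 0 < x < 1 -> is_derive H x (f x)) ->
  (forall x, 0 < x < 1 -> continuous f x) ->
  filterlim H (at_right 0) (locally l0) ->
  filterlim H (at_left 1) (locally l1) ->
  is_RInt_gen f (at_right 0) (at_left 1) (l1 - l0).
Proof.
  intros HD HC L0 L1 P HP.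
  assert (HL : filterlim (fun ab : R * R => minus (H (snd ab)) (H (fst ab)))
      (filter_prod (at_right 0) (at_left 1)) (locally (l1 - l0))).
  { refine (filterlim_comp_2 (G := locally l1) (H := locally (opp l0))
      (fun ab : R * R => H (snd ab)) (fun ab : R * R => opp (H (fst ab))) plus _ _ _).
    - apply filterlim_comp with (2 := L1); apply filterlim_snd.
    - apply filterlim_comp with (locally l0);
        [apply filterlim_comp with (2 := L0); apply filterlim_fst|].
      apply (filterlim_opp (V := R_NormedModule)).
    - apply (filterlim_plus (V := R_NormedModule)). }
  specialize (HL P HP); unfold filtermap in HL.
  generalize (filter_and _ _ HL
    (Filter_prod _ _ (fun ab : R * R => 0 < fst ab < 1 /\ 0 < snd ab < 1) _ _
       (at_right_interval 0 1 Rlt_0_1) (at_left_interval 0 1 Rlt_0_1)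
       (fun x y Hx Hy => conj Hx Hy))).
  unfold filtermapi; apply filter_imp; intros [a b] [HPab [Ha Hb]]; simpl in *.
  exists (minus (H b) (H a)); split; [|exact HPab].
  assert (Hin : forall x, Rmin a b <= x <= Rmax a b -> 0 < x < 1).
  { intros x; unfold Rmin, Rmax; destruct (Rle_dec a b); lra. }
  apply (is_RInt_derive H f); auto.
Qed.

Lemma ex_RInt_continuous_le (f : R -> R) (a b : R) :
  a <= b -> (forall x, a <= x <= b -> continuous f x) -> ex_RInt f a b.
Proof.
  intros Hab Hf; apply (ex_RInt_continuous (V := R_CompleteNormedModule)).
  rewrite Rmin_left, Rmax_right by lra; exact Hf.
Qed.

Lemma is_derive_RInt_upper (f : R -> R) (c y : R) :
  (forall x, 0 <= x < c -> continuous f x) -> 0 < y < c ->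
  is_derive (fun y => RInt f 0 y) y (f y).
Proof.
  intros Hf Hy; apply (is_derive_RInt f (fun y => RInt f 0 y) 0 y).
  - assert (Hloc : locally y (fun u => 0 < u < c)).
    { apply filter_and;
        [apply (open_gt 0) | apply (open_lt c)]; apply Hy. }
    revert Hloc; apply filter_imp; intros u Hu.
    apply (RInt_correct (V := R_CompleteNormedModule)), ex_RInt_continuous_le; [lra|].
    intros x Hx; apply Hf; lra.
  - apply Hf; lra.
Qed.

(** Continuity is asked only on [[0, 1)] so that [/ ln t], which blows up at [1], is covered. A
    bound for [f] on [[0, 1/2]] suffices. *)
Lemma filterlim_RInt_at_right_0 (f : R -> R) :
  (forall x, 0 <= x < 1 -> continuous f x) ->
  filterlim (fun y => RInt f 0 y) (at_right 0) (locally 0).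
Proof.
  intros Hf.
  destruct (continuity_ab_maj (fun x => Rabs (f x)) 0 (/ 2)) as [m [Hm _]]; [lra| |].
  { intros c Hc; apply continuity_pt_filterlim.
    apply (continuous_comp f Rabs); [apply Hf; lra | apply continuous_Rabs]. }
  apply (filterlim_of_error _ _ (fun y => y * Rabs (f m))).
  - generalize (at_right_interval 0 (/ 2) ltac:(lra)); apply filter_imp; intros y Hy.
    rewrite Rminus_0_r.
    replace (y * Rabs (f m)) with ((y - 0) * Rabs (f m)) by ring.
    apply abs_RInt_le_const; [lra| |intros t Ht; apply Hm; lra].
    apply ex_RInt_continuous_le; [lra|]; intros x Hx; apply Hf; lra.
  - replace 0 with (0 * Rabs (f m)) at 2 by ring.
    apply (filterlim_at_right_continuous (fun y => y * Rabs (f m))).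
    apply (ex_derive_continuous (V := R_NormedModule)); auto_derive; auto.
Qed.

Lemma filterlim_RInt_at_left_1 (f : R -> R) :
  (forall x, 0 <= x <= 1 -> continuous f x) ->
  filterlim (fun y => RInt f 0 y) (at_left 1) (locally (RInt f 0 1)).
Proof.
  intros Hf.
  destruct (continuity_ab_maj (fun x => Rabs (f x)) 0 1) as [m [Hm _]]; [lra| |].
  { intros c Hc; apply continuity_pt_filterlim.
    apply (continuous_comp f Rabs); [apply Hf, Hc | apply continuous_Rabs]. }
  apply (filterlim_of_error _ _ (fun y => (1 - y) * Rabs (f m))).
  - generalize (at_left_interval 0 1 Rlt_0_1); apply filter_imp; intros y Hy.
    assert (E1 : ex_RInt f 0 y).
    { apply ex_RInt_continuous_le; [lra|]; intros x Hx; apply Hf; lra. }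
    assert (E2 : ex_RInt f y 1).
    { apply ex_RInt_continuous_le; [lra|]; intros x Hx; apply Hf; lra. }
    assert (E : RInt f 0 y + RInt f y 1 = RInt f 0 1) by exact (RInt_Chasles f 0 y 1 E1 E2).
    rewrite Rabs_minus_sym; replace (RInt f 0 1 - RInt f 0 y) with (RInt f y 1) by lra.
    apply abs_RInt_le_const; [lra|exact E2|intros t Ht; apply Hm; lra].
  - replace 0 with ((1 - 1) * Rabs (f m)) by ring.
    apply (filterlim_at_left_continuous (fun y => (1 - y) * Rabs (f m))).
    apply (ex_derive_continuous (V := R_NormedModule)); auto_derive; auto.
Qed.

Lemma is_RInt_gen_01_ext (f h : R -> R) (l : R) :
  (forall x, 0 < x < 1 -> f x = h x) ->
  is_RInt_gen f (at_right 0) (at_left 1) l ->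
  is_RInt_gen h (at_right 0) (at_left 1) l.
Proof.
  intros Hfh; apply is_RInt_gen_ext.
  apply (Filter_prod _ _ _ _ _ (at_right_interval 0 1 Rlt_0_1) (at_left_interval 0 1 Rlt_0_1)).
  intros a b Ha Hb x; unfold Rmin, Rmax; simpl; destruct (Rle_dec a b);
    intros Hx; apply Hfh; lra.
Qed.

Lemma is_RInt_gen_01_continuous (f : R -> R) :
  (forall x, 0 <= x <= 1 -> continuous f x) ->
  is_RInt_gen f (at_right 0) (at_left 1) (RInt f 0 1).
Proof.
  intros Hf; replace (RInt f 0 1) with (RInt f 0 1 - 0) by ring.
  apply (is_RInt_gen_01_antiderivative f (fun y => RInt f 0 y)).
  - intros x Hx; apply (is_derive_RInt_upper f 1); [|exact Hx].
    intros u Hu; apply Hf; lra.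
  - intros x Hx; apply Hf; lra.
  - apply filterlim_RInt_at_right_0; intros x Hx; apply Hf; lra.
  - apply filterlim_RInt_at_left_1, Hf.
Qed.

(** Serves to evaluate a proper integral through a primitive that is known only inside [(0, 1)]. *)
Lemma RInt_01_eq_is_RInt_gen (f : R -> R) (l : R) :
  (forall x, 0 <= x <= 1 -> continuous f x) ->
  is_RInt_gen f (at_right 0) (at_left 1) l -> RInt f 0 1 = l.
Proof.
  intros Hf Hl.
  apply (is_RInt_gen_unique (V := R_CompleteNormedModule)) in Hl.
  rewrite <- Hl; symmetry.
  apply (is_RInt_gen_unique (V := R_CompleteNormedModule)), is_RInt_gen_01_continuous, Hf.
Qed.

(** Balls of [C] as a real product space are boxes, and the endpoints that work for both components
    form an intersection of two sets of the filter. *)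
Lemma is_int01_pair (f : R -> C) (l1 l2 : R) :
  is_RInt_gen (fun x => Re (f x)) (at_right 0) (at_left 1) l1 ->
  is_RInt_gen (fun x => Im (f x)) (at_right 0) (at_left 1) l2 ->
  is_int01 f (l1, l2).
Proof.
  intros H1 H2 P [eps HP].
  specialize (H1 _ (locally_ball l1 eps)); specialize (H2 _ (locally_ball l2 eps)).
  unfold filtermapi in *; generalize (filter_and _ _ H1 H2).
  apply filter_imp; intros ab [[y1 [I1 B1]] [y2 [I2 B2]]].
  exists (y1, y2); split.
  - exact (is_RInt_fct_extend_pair (U := R_NormedModule) (V := R_NormedModule)
      f (fst ab) (snd ab) y1 y2 I1 I2).
  - apply HP; split; assumption.
Qed.

(** * The weight 1 / ln x + 1 / (1 - x) *)

Lemma ln_le_sub_1 (x : R) : 0 < x -> ln x <= x - 1.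
Proof.
  intros Hx; pose proof (exp_ineq1_le (ln x)) as H.
  rewrite exp_ln in H by assumption; lra.
Qed.

Lemma ln_ge_1_sub_inv (x : R) : 0 < x -> 1 - / x <= ln x.
Proof.
  intros Hx; pose proof (ln_le_sub_1 (/ x) (Rinv_0_lt_compat _ Hx)) as H.
  rewrite ln_Rinv in H by assumption; lra.
Qed.

Lemma ln_neg (x : R) : 0 < x < 1 -> ln x < 0.
Proof. intros Hx; pose proof (ln_le_sub_1 x (proj1 Hx)); lra. Qed.

Lemma ln_nonpos_arg (x : R) : x <= 0 -> ln x = 0.
Proof. intros Hx; unfold ln; destruct (Rlt_dec 0 x); [exfalso; lra | reflexivity]. Qed.

Lemma le_of_nonneg_derive (f df : R -> R) (a b : R) :
  a <= b -> (forall x, a <= x <= b -> is_derive f x (df x)) ->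
  (forall x, a <= x <= b -> 0 <= df x) -> f a <= f b.
Proof.
  intros Hab Hf Hdf.
  destruct (MVT_gen f a b df) as [c [Hc E]]; rewrite ?Rmin_left, ?Rmax_right in * by lra.
  - intros x Hx; apply Hf; lra.
  - intros x Hx; apply continuity_pt_filterlim.
    apply (ex_derive_continuous (V := R_NormedModule)); exists (df x); apply Hf; lra.
  - pose proof (Hdf c Hc); nra.
Qed.

(** The difference of the two sides vanishes at [1] and has derivative
    [(t - 1)^2 / (t (t + 1)^2) >= 0]. This gives the lower bound of [log_weight]. *)
Lemma ln_le_pade (x : R) : 0 < x <= 1 -> ln x <= 2 * (x - 1) / (x + 1).
Proof.
  intros Hx.
  enough (H : ln x - 2 * (x - 1) / (x + 1) <= ln 1 - 2 * (1 - 1) / (1 + 1)).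
  { rewrite ln_1 in H; lra. }
  apply (le_of_nonneg_derive (fun t => ln t - 2 * (t - 1) / (t + 1))
    (fun t => (t - 1) ^ 2 / (t * (t + 1) ^ 2))); [lra| |].
  - intros t Ht; auto_derive; [lra|]; field; lra.
  - intros t Ht; apply Rdiv_le_0_compat; [apply pow2_ge_0|].
    apply Rmult_lt_0_compat; [lra | apply pow_lt; lra].
Qed.

(** Same monotonicity argument, now with derivative [(t - 1)^2 / (2 t^2)]. This gives the upper
    bound of [log_weight]. *)
Lemma ln_ge_half (x : R) : 0 < x <= 1 -> (x ^ 2 - 1) / (2 * x) <= ln x.
Proof.
  intros Hx.
  enough (H : (x ^ 2 - 1) / (2 * x) - ln x <= (1 ^ 2 - 1) / (2 * 1) - ln 1).
  { rewrite ln_1 in H; lra. }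
  apply (le_of_nonneg_derive (fun t => (t ^ 2 - 1) / (2 * t) - ln t)
    (fun t => (t - 1) ^ 2 / (2 * t ^ 2))); [lra| |].
  - intros t Ht; auto_derive; [lra|]; field; lra.
  - intros t Ht; apply Rdiv_le_0_compat; [apply pow2_ge_0|].
    apply Rmult_lt_0_compat; [lra | apply pow_lt; lra].
Qed.

(* At [0] both values are [0], because [ln] vanishes on nonpositive arguments and [/ 0 = 0]. *)
Lemma continuous_inv_ln (x : R) : 0 <= x < 1 -> continuous (fun t => / ln t) x.
Proof.
  intros [[Hx | <-] Hx1].
  - apply continuous_Rinv_comp; [apply continuous_ln, Hx|].
    apply Rlt_not_eq, ln_neg; lra.
  - assert (E0 : / ln 0 = 0) by (rewrite (ln_nonpos_arg 0), Rinv_0; lra).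
    apply continuous_of_sided; rewrite E0.
    + apply (filterlim_of_error _ _ (fun _ => 0)); [|apply filterlim_const].
      generalize (at_left_interval (-1) 0 ltac:(lra)); apply filter_imp; intros t Ht.
      rewrite (ln_nonpos_arg t), Rinv_0, Rminus_0_r, Rabs_R0; lra.
    + apply filterlim_comp with (1 := is_lim_ln_0).
      apply (filterlim_Rbar_inv m_infty); discriminate.
Qed.

(* The constant on [[1, +oo)] is the limit at [1]. *)
Definition log_weight (x : R) : R :=
  if Rle_dec 1 x then / 2 else / ln x + / (1 - x).

Lemma log_weight_lt_1 (x : R) : x < 1 -> log_weight x = / ln x + / (1 - x).
Proof. intros Hx; unfold log_weight; destruct (Rle_dec 1 x); lra. Qed.

(** Obtained by inverting the two rational bounds on [- ln x]. The bounds meet at [x = 1], which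
    makes the weight continuous there. *)
Lemma log_weight_bounds (x : R) : 0 < x < 1 -> / 2 <= log_weight x <= / (1 + x).
Proof.
  intros Hx; rewrite log_weight_lt_1 by lra.
  pose proof (ln_neg x Hx) as Hln.
  pose proof (ln_le_pade x ltac:(lra)) as H1.
  pose proof (ln_ge_half x ltac:(lra)) as H2.
  assert (I1 : / (- ln x) <= / (2 * (1 - x) / (x + 1))).
  { apply Rinv_le_contravar; [apply Rdiv_lt_0_compat; lra|].
    replace (2 * (1 - x) / (x + 1)) with (- (2 * (x - 1) / (x + 1))) by (field; lra); lra. }
  assert (I2 : / ((1 - x ^ 2) / (2 * x)) <= / (- ln x)).
  { apply Rinv_le_contravar; [lra|].
    replace ((1 - x ^ 2) / (2 * x)) with (- ((x ^ 2 - 1) / (2 * x))) by (field; lra); lra. }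
  rewrite Rinv_opp in I1, I2; split.
  - replace (/ 2) with (/ (1 - x) - / (2 * (1 - x) / (x + 1))) by (field; lra); lra.
  - replace (/ (1 + x)) with (/ (1 - x) - / ((1 - x ^ 2) / (2 * x))); [lra|].
    field; repeat split; try lra.
    replace (1 - x ^ 2) with ((1 - x) * (1 + x)) by ring; nra.
Qed.

(** The upper bound is attained at [0], where the convention [/ ln 0 = 0] leaves [/ (1 - 0)]. *)
Lemma log_weight_01 (x : R) : 0 <= x <= 1 -> 0 <= log_weight x <= 1.
Proof.
  intros [[Hx | <-] Hx1].
  - destruct Hx1 as [Hx1 | ->].
    + pose proof (log_weight_bounds x ltac:(lra)) as [H1 H2].
      assert (/ (1 + x) <= / 1) by (apply Rinv_le_contravar; lra); lra.
    + unfold log_weight; destruct (Rle_dec 1 1); lra.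
  - rewrite log_weight_lt_1, (ln_nonpos_arg 0), Rinv_0 by lra; lra.
Qed.

Lemma continuous_log_weight (x : R) : 0 <= x <= 1 -> continuous log_weight x.
Proof.
  intros [H0 [Hx | ->]].
  - apply (continuous_ext_loc _ (fun t => / ln t + / (1 - t))).
    + generalize (open_lt 1 x Hx); apply filter_imp; intros t Ht.
      symmetry; apply log_weight_lt_1, Ht.
    + apply (continuous_plus (V := R_NormedModule)); [apply continuous_inv_ln; lra|].
      apply (ex_derive_continuous (V := R_NormedModule)); auto_derive; lra.
  - assert (E1 : log_weight 1 = / 2) by (unfold log_weight; destruct (Rle_dec 1 1); lra).
    apply continuous_of_sided; rewrite E1.
    + apply (filterlim_of_error _ _ (fun t => / (1 + t) - / 2)).
      * generalize (at_left_interval 0 1 Rlt_0_1); apply filter_imp; intros t Ht.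
        pose proof (log_weight_bounds t Ht); apply Rabs_le; lra.
      * replace 0 with (/ (1 + 1) - / 2) by field.
        apply (filterlim_at_left_continuous (fun t => / (1 + t) - / 2)).
        apply (ex_derive_continuous (V := R_NormedModule)); auto_derive; lra.
    + apply (filterlim_of_error _ _ (fun _ => 0)); [|apply filterlim_const].
      generalize (at_right_interval 1 2 ltac:(lra)); apply filter_imp; intros t Ht.
      unfold log_weight; destruct (Rle_dec 1 t); [|lra].
      rewrite Rminus_diag, Rabs_R0; lra.
Qed.

(** * The coefficients of the series *)

(** The logarithmic integral, used only for [y < 1], where no principal value is involved. *)
Definition li (y : R) : R := RInt (fun t => / ln t) 0 y.

Lemma is_derive_li (y : R) : 0 < y < 1 -> is_derive li y (/ ln y).
Proof.
  intros Hy; apply (is_derive_RInt_upper (fun t => / ln t) 1); [exact continuous_inv_ln | exact Hy].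
Qed.

Lemma is_derive_ln_ln (t : R) :
  0 < t < 1 -> is_derive (fun t => ln (- ln t)) t (/ (t * ln t)).
Proof.
  intros Ht; pose proof (ln_neg t Ht).
  auto_derive; [split; [lra | split; [lra | auto]] | field; lra].
Qed.

(* [1 / (t ln t) <= 1 / ln t <= q / (t ln t)] on [[q, p]], and [ln (- ln t)] is a
   primitive of [1 / (t ln t)]. *)
Lemma li_diff_bounds (q p : R) :
  0 < q <= p -> p < 1 ->
  ln (- ln p) - ln (- ln q) <= li p - li q <= q * (ln (- ln p) - ln (- ln q)).
Proof.
  intros Hq Hp; split.
  - enough (H : li q - ln (- ln q) <= li p - ln (- ln p)) by lra.
    apply (le_of_nonneg_derive (fun t => li t - ln (- ln t))
      (fun t => / ln t - / (t * ln t))); [lra| |]; intros t Ht.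
    + apply (is_derive_minus (V := R_NormedModule) li (fun t => ln (- ln t)));
        [apply is_derive_li | apply is_derive_ln_ln]; lra.
    + pose proof (ln_neg t ltac:(lra)).
      replace (/ ln t - / (t * ln t)) with ((1 - t) / (t * - ln t)) by (field; lra).
      apply Rdiv_le_0_compat; [lra | apply Rmult_lt_0_compat; lra].
  - enough (H : q * ln (- ln q) - li q <= q * ln (- ln p) - li p) by lra.
    apply (le_of_nonneg_derive (fun t => q * ln (- ln t) - li t)
      (fun t => q * / (t * ln t) - / ln t)); [lra| |]; intros t Ht.
    + apply (is_derive_minus (V := R_NormedModule) (fun t => q * ln (- ln t)) li);
        [apply (is_derive_scal (fun t => ln (- ln t))), is_derive_ln_ln
        | apply is_derive_li]; lra.
    + pose proof (ln_neg t ltac:(lra)).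
      replace (q * / (t * ln t) - / ln t) with ((t - q) / (t * - ln t)) by (field; lra).
      apply Rdiv_le_0_compat; [lra | apply Rmult_lt_0_compat; lra].
Qed.

Lemma pow_in_01 (x : R) (n : nat) : 0 < x < 1 -> 0 < x ^ S n < 1.
Proof.
  intros Hx; split; [apply pow_lt; lra|].
  apply pow_lt_1_compat; [lra | lia].
Qed.

Lemma continuous_pow (n : nat) (x : R) : continuous (fun t => t ^ n) x.
Proof.
  apply (ex_derive_continuous (V := R_NormedModule)); auto_derive; auto.
Qed.

Lemma is_derive_pow_S (n : nat) (x : R) :
  is_derive (fun t => t ^ S n) x (INR (S n) * x ^ n).
Proof.
  rewrite <- (Rmult_1_r (INR (S n))).
  exact (is_derive_pow (fun t => t) (S n) x 1 (is_derive_id x)).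
Qed.

(** The exponent separates from [x], so the differences of [ln (- ln _)] in [li_diff_bounds] between
    two powers of [x] do not depend on [x]. *)
Lemma ln_ln_pow (x : R) (n : nat) :
  0 < x < 1 -> ln (- ln (x ^ S n)) = ln (INR (S n)) + ln (- ln x).
Proof.
  intros Hx; pose proof (ln_neg x Hx).
  rewrite ln_pow by lra.
  rewrite <- ln_mult by (try apply lt_0_INR; try lia; lra).
  f_equal; ring.
Qed.

Lemma filterlim_li_pow_at_right_0 (n : nat) :
  filterlim (fun x => li (x ^ S n)) (at_right 0) (locally 0).
Proof.
  apply filterlim_comp with (at_right 0);
    [|apply filterlim_RInt_at_right_0, continuous_inv_ln].
  intros P [eps HP].
  assert (H0 : locally 0 (fun x => ball 0 eps (x ^ S n))).
  { apply (proj1 (filterlim_locally (F := locally 0) (fun x => x ^ S n) 0)).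
    replace 0 with (0 ^ S n) at 2 by (simpl; ring); apply continuous_pow. }
  unfold filtermap, at_right, within in *.
  revert H0; apply filter_imp; intros x Hx Hx0.
  apply HP; [exact Hx | apply pow_lt, Hx0].
Qed.

(** Each [li] term diverges at [1], but [li_diff_bounds] with [q = x^(k+2)] and [p = x^(k+1)]
    encloses their difference between [L] and [q * L], and [q] tends to [1]. *)
Lemma filterlim_li_pow_diff_at_left_1 (k : nat) :
  filterlim (fun x => li (x ^ S k) - li (x ^ S (S k))) (at_left 1)
    (locally (- ln (INR (S (S k)) / INR (S k)))).
Proof.
  assert (P1 : 0 < INR (S k)) by (apply lt_0_INR; lia).
  assert (P2 : INR (S k) < INR (S (S k))) by (apply lt_INR; lia).
  set (L := - ln (INR (S (S k)) / INR (S k))).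
  apply (filterlim_of_error _ _ (fun x => (x ^ S (S k) - 1) * L)).
  - generalize (at_left_interval 0 1 Rlt_0_1); apply filter_imp; intros x Hx.
    pose proof (pow_in_01 x k Hx) as Hp; pose proof (pow_in_01 x (S k) Hx) as Hq.
    assert (Hqp : x ^ S (S k) <= x ^ S k).
    { change (x ^ S (S k)) with (x * x ^ S k); nra. }
    destruct (li_diff_bounds (x ^ S (S k)) (x ^ S k)) as [H1 H2]; [lra|lra|].
    rewrite !ln_ln_pow in H1, H2 by exact Hx.
    assert (EL : ln (INR (S k)) + ln (- ln x) - (ln (INR (S (S k))) + ln (- ln x)) = L).
    { unfold L; rewrite ln_div by lra; ring. }
    rewrite EL in H1, H2; apply Rabs_le; split; lra.
  - replace 0 with ((1 ^ S (S k) - 1) * L) by (rewrite pow1; ring).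
    apply (filterlim_at_left_continuous (fun x => (x ^ S (S k) - 1) * L)).
    apply (ex_derive_continuous (V := R_NormedModule)); auto_derive; auto.
Qed.

Lemma continuous_log_weight_mult (f : R -> R) (x : R) :
  0 <= x <= 1 -> continuous f x -> continuous (fun x => log_weight x * f x) x.
Proof.
  intros Hx Hf; apply (continuous_mult (K := R_AbsRing) log_weight f);
    [apply continuous_log_weight, Hx | exact Hf].
Qed.

(** Since [log_weight x * (1 - x) = (1 - x) / ln x + 1], a primitive is [li (x^(k+1)) - li (x^(k+2))
    + x^(k+1) / (k+1)]: in the derivative of [li (x^n)] the factor [n] cancels against
    [ln (x^n) = n ln x]. *)
Lemma RInt_log_weight_pow (k : nat) :
  RInt (fun x => log_weight x * ((1 - x) * x ^ k)) 0 1 = gamma_coef k.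
Proof.
  assert (P1 : 0 < INR (S k)) by (apply lt_0_INR; lia).
  assert (Hcont : forall x, 0 <= x <= 1 ->
      continuous (fun x => log_weight x * ((1 - x) * x ^ k)) x).
  { intros x Hx; apply (continuous_log_weight_mult (fun x => (1 - x) * x ^ k)); [exact Hx|].
    apply (ex_derive_continuous (V := R_NormedModule)); auto_derive; auto. }
  apply RInt_01_eq_is_RInt_gen; [exact Hcont|].
  (* The coefficient is written as the limit of the primitive at [1] minus its limit at [0]. *)
  replace (gamma_coef k)
    with (- ln (INR (S (S k)) / INR (S k)) + 1 ^ S k / INR (S k)
          - (0 - 0 + 0 ^ S k / INR (S k))).
  2:{ unfold gamma_coef; rewrite pow1; simpl (0 ^ _); field; lra. }
  apply (is_RInt_gen_01_antiderivative _
    (fun x => li (x ^ S k) - li (x ^ S (S k)) + x ^ S k / INR (S k))).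
  - intros x Hx.
    pose proof (pow_in_01 x k Hx) as Hp; pose proof (pow_in_01 x (S k) Hx) as Hq.
    pose proof (ln_neg x Hx); pose proof (pow_lt x k (proj1 Hx)).
    assert (D1 := is_derive_comp li (fun x => x ^ S k) x _ (INR (S k) * x ^ k)
      (is_derive_li _ Hp) (is_derive_pow_S k x)).
    assert (D2 := is_derive_comp li (fun x => x ^ S (S k)) x _ (INR (S (S k)) * x ^ S k)
      (is_derive_li _ Hq) (is_derive_pow_S (S k) x)).
    assert (D3 : is_derive (fun x => x ^ S k / INR (S k)) x (x ^ k)).
    { replace (x ^ k) with (/ INR (S k) * (INR (S k) * x ^ k)) by (field; lra).
      apply (is_derive_ext (fun t => / INR (S k) * t ^ S k)); [intros t; apply Rmult_comm|].
      apply (is_derive_scal (fun t => t ^ S k)), is_derive_pow_S. }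
    assert (D := is_derive_plus (V := R_NormedModule) _ _ _ _ _
      (is_derive_minus (V := R_NormedModule) _ _ _ _ _ D1 D2) D3).
    eapply is_derive_ext; [|replace (log_weight x * ((1 - x) * x ^ k)) with
      (plus (minus (scal (INR (S k) * x ^ k) (/ ln (x ^ S k)))
                   (scal (INR (S (S k)) * x ^ S k) (/ ln (x ^ S (S k))))) (x ^ k));
      [exact D|]].
    + intros t; reflexivity.
    + rewrite log_weight_lt_1, !ln_pow by lra.
      unfold plus, minus, scal, opp; simpl; unfold plus, mult, opp; simpl.
      assert (0 < INR (S (S k))) by (apply lt_0_INR; lia).
      change (match k with 0%nat => 1 | S _ => INR k + 1 end) with (INR (S k)).
      change (INR (S k) + 1) with (INR (S (S k))).
      field; repeat split; lra.
  - intros x Hx; apply Hcont; lra.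
  - apply (filterlim_comp_2 (G := locally (0 - 0)) (H := locally (0 ^ S k / INR (S k)))
      _ _ Rplus).
    + apply (filterlim_comp_2 (G := locally 0) (H := locally (- 0))
        (fun x => li (x ^ S k)) (fun x => - li (x ^ S (S k))) Rplus);
        [apply filterlim_li_pow_at_right_0 | |
         apply (filterlim_plus (V := R_NormedModule) 0 (- 0))].
      apply filterlim_comp with (1 := filterlim_li_pow_at_right_0 (S k)).
      apply (filterlim_opp (V := R_NormedModule) 0).
    + apply (filterlim_at_right_continuous (fun x => x ^ S k / INR (S k))).
      apply (ex_derive_continuous (V := R_NormedModule)); auto_derive; auto.
    + apply (filterlim_plus (V := R_NormedModule)).
  - apply (filterlim_comp_2 (G := locally (- ln (INR (S (S k)) / INR (S k))))
      (H := locally (1 ^ S k / INR (S k))) _ _ Rplus);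
      [apply filterlim_li_pow_diff_at_left_1 | |
       apply (filterlim_plus (V := R_NormedModule))].
    apply (filterlim_at_left_continuous (fun x => x ^ S k / INR (S k))).
    apply (ex_derive_continuous (V := R_NormedModule)); auto_derive; auto.
Qed.

(** * The double integral *)

Lemma RInt_lin (f g : R -> R) (a b y : R) :
  0 <= y -> (forall x, 0 <= x <= y -> continuous f x) ->
  (forall x, 0 <= x <= y -> continuous g x) ->
  is_RInt (fun x => a * f x + b * g x) 0 y (a * RInt f 0 y + b * RInt g 0 y).
Proof.
  intros Hy Hf Hg.
  apply (is_RInt_plus (V := R_NormedModule) (fun x => a * f x) (fun x => b * g x));
    apply (is_RInt_scal (V := R_NormedModule)), (RInt_correct (V := R_CompleteNormedModule));
    apply ex_RInt_continuous_le; assumption.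
Qed.

Lemma bounded_continuous_01 (m : R -> R) :
  (forall x, 0 <= x <= 1 -> continuous m x) ->
  exists M, 0 <= M /\ forall x, 0 <= x <= 1 -> Rabs (m x) <= M.
Proof.
  intros Hm.
  destruct (continuity_ab_maj (fun x => Rabs (m x)) 0 1) as [c [Hc _]]; [lra| |].
  { intros c Hc; apply continuity_pt_filterlim.
    apply (continuous_comp m Rabs); [apply Hm, Hc | apply continuous_Rabs]. }
  exists (Rabs (m c)); split; [apply Rabs_pos | exact Hc].
Qed.

(** With [m] the real or imaginary part of [(1 - u) / (1 - u z)], this is the corresponding part of
    [1 / ((1 - u z) * (- ln u))]. Factoring out [1 / (1 - u)] keeps [m] continuous on [[0, 1]] even
    for [z = 1]. *)
Definition kern (m : R -> R) (u : R) : R := - (m u / (1 - u)) * / ln u.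

Lemma continuous_div_1_sub (m : R -> R) (u : R) :
  u < 1 -> continuous m u -> continuous (fun u => m u / (1 - u)) u.
Proof.
  intros Hu Hm; apply (continuous_mult (K := R_AbsRing) m (fun u => / (1 - u))); [exact Hm|].
  apply (ex_derive_continuous (V := R_NormedModule)); auto_derive; lra.
Qed.

Section DoubleIntegral.

Context (m : R -> R) (Hm : forall x, 0 <= x <= 1 -> continuous m x).

Lemma continuous_kern (u : R) : 0 <= u < 1 -> continuous (kern m) u.
Proof.
  intros Hu.
  apply (continuous_mult (K := R_AbsRing) (fun u => - (m u / (1 - u))) (fun u => / ln u));
    [|apply continuous_inv_ln, Hu].
  apply (continuous_opp (V := R_NormedModule) (fun u => m u / (1 - u))).
  apply continuous_div_1_sub; [lra | apply Hm; lra].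
Qed.

Lemma continuous_id_kern (u : R) : 0 <= u < 1 -> continuous (fun u => u * kern m u) u.
Proof.
  intros Hu; apply (continuous_mult (K := R_AbsRing) (fun u => u) (kern m));
    [apply continuous_id | apply continuous_kern, Hu].
Qed.

(** These three integrals have integrands free of [y], so differentiation in [y] needs only the
    fundamental theorem. [N] stands for the integral of [- ln u * kern m u], which equals
    [m u / (1 - u)] for [0 < u < 1]. *)
Let K0 (y : R) : R := RInt (kern m) 0 y.
Let K1 (y : R) : R := RInt (fun u => u * kern m u) 0 y.
Let N (y : R) : R := RInt (fun u => m u / (1 - u)) 0 y.

Let inner (y : R) : R := K0 y / y - K1 y / y ^ 2.

Lemma is_derive_K0 y : 0 < y < 1 -> is_derive K0 y (kern m y).
Proof. apply (is_derive_RInt_upper (kern m) 1), continuous_kern. Qed.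

Lemma is_derive_K1 y : 0 < y < 1 -> is_derive K1 y (y * kern m y).
Proof. apply (is_derive_RInt_upper (fun u => u * kern m u) 1), continuous_id_kern. Qed.

Lemma is_derive_N y : 0 < y < 1 -> is_derive N y (m y / (1 - y)).
Proof.
  apply (is_derive_RInt_upper (fun u => m u / (1 - u)) 1).
  intros x Hx; apply continuous_div_1_sub; [lra | apply Hm; lra].
Qed.

(** The substitution [u = x y] turns [(1 - x) dx] into [(y - u) / y^2 du]. *)
Lemma inner_integral (y : R) :
  0 < y < 1 ->
  is_RInt_gen (fun x => (1 - x) * kern m (x * y)) (at_right 0) (at_left 1) (inner y).
Proof.
  intros Hy.
  assert (I : is_RInt (fun u => / y * kern m u + - / y ^ 2 * (u * kern m u)) 0 y (inner y)).
  { replace (inner y) with (/ y * K0 y + - / y ^ 2 * K1 y) by (unfold inner; field; lra).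
    apply (RInt_lin (kern m) (fun u => u * kern m u)); [lra| |]; intros x Hx;
      [apply continuous_kern | apply continuous_id_kern]; lra. }
  replace (inner y) with (RInt (fun x => (1 - x) * kern m (x * y)) 0 1).
  - apply is_RInt_gen_01_continuous; intros x Hx.
    apply (continuous_mult (K := R_AbsRing) (fun x => 1 - x) (fun x => kern m (x * y))).
    + apply (ex_derive_continuous (V := R_NormedModule)); auto_derive; auto.
    + apply (continuous_comp (fun x => x * y) (kern m)); [|apply continuous_kern; nra].
      apply (ex_derive_continuous (V := R_NormedModule)); auto_derive; auto.
  - apply (is_RInt_unique (V := R_CompleteNormedModule)).
    (* The bounds [0] and [y] are brought to the form [y * 0 + 0] and [y * 1 + 0] required by the
       linear substitution. *)
    rewrite <- (Rmult_0_r y), <- (Rplus_0_r (y * 0)) in I.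
    replace (is_RInt _ _ y) with (is_RInt (V := R_NormedModule)
      (fun u => / y * kern m u + - / y ^ 2 * (u * kern m u)) (y * 0 + 0) (y * 1 + 0)) in I
      by (f_equal; ring).
    apply (is_RInt_comp_lin (V := R_NormedModule)) in I.
    revert I; apply is_RInt_ext; intros x Hx.
    unfold scal; simpl; unfold mult; simpl.
    rewrite Rplus_0_r, (Rmult_comm x y); field; lra.
Qed.

(* Differentiating [y |-> int_0^y (ln (y / u) + u / y - 1) k(u) du] gives the inner
   integral [int_0^y (y - u) / y^2 k(u) du]. *)
Let outer_prim (y : R) : R := (ln y - 1) * K0 y + / y * K1 y + N y.

(** The terms coming from the upper limit cancel, because [ln (y / u) + u / y - 1] vanishes at
    [u = y]; only the derivatives of the coefficients remain. *)
Lemma is_derive_outer_prim y : 0 < y < 1 -> is_derive outer_prim y (inner y).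
Proof.
  intros Hy.
  pose proof (is_derive_K0 y Hy) as D0; pose proof (is_derive_K1 y Hy) as D1.
  pose proof (is_derive_N y Hy) as DN; pose proof (ln_neg y Hy).
  (* With their bodies removed, [K0], [K1] and [N] are opaque to [auto_derive], which then asks for
     their differentiability. *)
  unfold outer_prim, inner; clear outer_prim inner; clearbody K0 K1 N; auto_derive.
  - repeat split; try lra; [exists (kern m y) | exists (y * kern m y) | exists (m y / (1 - y))];
      assumption.
  - apply is_derive_unique in D0, D1, DN.
    change (Derive (fun x : R => K0 x) y) with (Derive K0 y).
    change (Derive (fun x : R => K1 x) y) with (Derive K1 y).
    change (Derive (fun x : R => N x) y) with (Derive N y).
    rewrite D0, D1, DN.
    unfold kern; field; lra.
Qed.

Lemma continuous_inner y : 0 < y < 1 -> continuous inner y.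
Proof.
  intros Hy; apply (ex_derive_continuous (V := R_NormedModule)).
  pose proof (is_derive_K0 y Hy) as D0; pose proof (is_derive_K1 y Hy) as D1.
  unfold inner; clear outer_prim inner; clearbody K0 K1; auto_derive.
  repeat split; try nra; [exists (kern m y) | exists (y * kern m y)]; assumption.
Qed.

Lemma outer_prim_integral y :
  0 <= y < 1 ->
  is_RInt (fun u => (ln y - 1) * kern m u + / y * (u * kern m u) + m u / (1 - u)) 0 y (outer_prim y).
Proof.
  intros Hy.
  apply (is_RInt_plus (V := R_NormedModule)
    (fun u => (ln y - 1) * kern m u + / y * (u * kern m u)) (fun u => m u / (1 - u))).
  - apply (RInt_lin (kern m) (fun u => u * kern m u)); [lra| |]; intros x Hx;
      [apply continuous_kern | apply continuous_id_kern]; lra.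
  - apply (RInt_correct (V := R_CompleteNormedModule)), ex_RInt_continuous_le; [lra|].
    intros x Hx; apply continuous_div_1_sub; [lra | apply Hm; lra].
Qed.

Lemma kern_0 : kern m 0 = 0.
Proof. unfold kern; rewrite (ln_nonpos_arg 0), Rinv_0 by lra; ring. Qed.

(** For [y < 1/2] the integrand is at most [2 M] in absolute value, with [M] a bound for [m], so the
    integral is [O(y)]. *)
Lemma filterlim_outer_prim_at_right_0 : filterlim outer_prim (at_right 0) (locally 0).
Proof.
  destruct (bounded_continuous_01 m Hm) as [M [HM0 HM]].
  apply (filterlim_of_error _ _ (fun y => y * (2 * M))).
  - generalize (at_right_interval 0 (/ 2) ltac:(lra)); apply filter_imp; intros y Hy.
    rewrite Rminus_0_r; replace (y * (2 * M)) with ((y - 0) * (2 * M)) by ring.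
    apply (norm_RInt_le_const (V := R_NormedModule)) with (3 := outer_prim_integral y ltac:(lra)); [lra|].
    intros u Hu; change (norm ?x) with (Rabs x).
    assert (Hdiv : Rabs (m u / (1 - u)) <= 2 * M).
    { pose proof (HM u ltac:(lra)).
      unfold Rdiv; rewrite Rabs_mult, Rabs_inv, (Rabs_pos_eq (1 - u)) by lra.
      assert (/ (1 - u) <= 2) by (rewrite <- (Rinv_inv 2); apply Rinv_le_contravar; lra).
      assert (0 < / (1 - u)) by (apply Rinv_0_lt_compat; lra).
      pose proof (Rabs_pos (m u)); nra. }
    destruct Hu as [[Hu | <-] Huy].
    + pose proof (ln_neg u ltac:(lra)) as Hlu.
      (* The logarithm in the kernel compensates the one in its coefficient: [t >= 0] by
         [ln (u / y) <= u / y - 1], and [t <= 1] because [ln y < 0] and [u / y <= 1]. *)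
      set (t := (ln y - ln u + u / y - 1) / - ln u).
      replace ((ln y - 1) * kern m u + / y * (u * kern m u) + m u / (1 - u))
        with (t * (m u / (1 - u))) by (unfold t, kern; field; lra).
      assert (Ht : 0 <= t <= 1).
      { pose proof (ln_le_sub_1 (u / y) ltac:(apply Rdiv_lt_0_compat; lra)) as E.
        rewrite ln_div in E by lra.
        pose proof (ln_neg y ltac:(lra)).
        assert (u / y <= 1) by (apply Rle_div_l; lra).
        unfold t; split; [apply Rdiv_le_0_compat | apply Rle_div_l]; lra. }
      rewrite Rabs_mult, (Rabs_pos_eq t) by lra.
      pose proof (Rabs_pos (m u / (1 - u))); nra.
    (* At [u = 0] the default value of [/ ln 0] kills the kernel terms. *)
    + rewrite kern_0; replace ((ln y - 1) * 0 + / y * (0 * 0) + m 0 / (1 - 0))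
        with (m 0 / (1 - 0)) by ring; exact Hdiv.
  - replace 0 with (0 * (2 * M)) at 2 by ring.
    apply (filterlim_at_right_continuous (fun y => y * (2 * M))).
    apply (ex_derive_continuous (V := R_NormedModule)); auto_derive; auto.
Qed.

Lemma kern_bound M u :
  0 <= M -> Rabs (m u) <= M -> 0 <= u < 1 -> Rabs (kern m u) <= M * / (1 - u) ^ 2.
Proof.
  intros HM0 HM Hu.
  assert (0 < / (1 - u) ^ 2) by (apply Rinv_0_lt_compat, pow_lt; lra).
  destruct Hu as [[Hu | <-] Hu1]; [|rewrite kern_0, Rabs_R0; nra].
  pose proof (ln_le_sub_1 u Hu) as Hln.
  assert (I : / - ln u <= / (1 - u)) by (apply Rinv_le_contravar; lra).
  assert (0 < / - ln u) by (apply Rinv_0_lt_compat; lra).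
  replace (kern m u) with (m u * (/ (1 - u) * / - ln u)) by (unfold kern; field; lra).
  assert (0 < / (1 - u)) by (apply Rinv_0_lt_compat; lra).
  rewrite Rabs_mult, (Rabs_pos_eq (/ (1 - u) * / - ln u)) by nra.
  replace (/ (1 - u) ^ 2) with (/ (1 - u) * / (1 - u)) by (field; lra).
  apply Rmult_le_compat; [apply Rabs_pos | nra | exact HM | nra].
Qed.

(** With [r = sqrt s], [ln r >= 1 - 1 / r] gives [s * - ln s = - 2 r^2 ln r <= 2 (r - r^2)]. It
    gives an explicit rate for [s ln s -> 0]. *)
Lemma sqrt_bound_ln s : 0 < s -> s * - ln s <= 2 * sqrt s.
Proof.
  intros Hs; pose proof (sqrt_lt_R0 s Hs) as Hr.
  pose proof (ln_ge_1_sub_inv (sqrt s) Hr) as E.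
  assert (El : ln s = ln (sqrt s) + ln (sqrt s)).
  { rewrite <- ln_mult, sqrt_sqrt by lra; reflexivity. }
  rewrite <- (sqrt_sqrt s) at 1 by lra; rewrite El.
  assert (sqrt s * / sqrt s = 1) by (field; lra).
  nra.
Qed.

(** Since [log_weight u * m u = (u - 1 - ln u) * kern m u], the terms in [ln u] cancel in the
    difference of the integrands and [(ln y + u / y - u) * kern m u] is left. Its coefficient is
    small enough as [y -> 1] to absorb the singularity [1 / (1 - u)^2] of the kernel bound. *)
Lemma outer_prim_error M y :
  0 <= M -> (forall x, 0 <= x <= 1 -> Rabs (m x) <= M) -> / 2 < y < 1 ->
  Rabs (outer_prim y - RInt (fun u => log_weight u * m u) 0 y) <= M * (1 - y) + 4 * M * sqrt (1 - y).
Proof.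
  intros HM0 HM Hy.
  set (s := 1 - y).
  assert (Ig : is_RInt (fun u => log_weight u * m u) 0 y (RInt (fun u => log_weight u * m u) 0 y)).
  { apply (RInt_correct (V := R_CompleteNormedModule)), ex_RInt_continuous_le; [lra|].
    intros x Hx; apply continuous_log_weight_mult; [|apply Hm]; lra. }
  assert (I : is_RInt (fun u => (ln y + u / y - u) * kern m u) 0 y
      (outer_prim y - RInt (fun u => log_weight u * m u) 0 y)).
  { generalize (is_RInt_minus (V := R_NormedModule) _ _ _ _ _ _ (outer_prim_integral y ltac:(lra)) Ig).
    apply is_RInt_ext; rewrite Rmin_left, Rmax_right by lra; intros u Hu.
    pose proof (ln_neg u ltac:(lra)).
    unfold minus, plus, opp; simpl; rewrite log_weight_lt_1 by lra.
    unfold kern; field; lra. }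
  (* The majorant is the bound [Hc] below times [M / (1 - u)^2]; its primitives are [1 / (1 - u)]
     and [- ln (1 - u)]. *)
  assert (J : is_RInt (fun u => M * s ^ 2 / y * / (1 - u) ^ 2 + M * s / y * / (1 - u)) 0 y
      (M * s ^ 2 / y * (/ (1 - y) - / (1 - 0)) + M * s / y * (- ln (1 - y) - - ln (1 - 0)))).
  { apply (is_RInt_plus (V := R_NormedModule) (fun u => M * s ^ 2 / y * / (1 - u) ^ 2)
      (fun u => M * s / y * / (1 - u))).
    - apply (is_RInt_scal (V := R_NormedModule) (fun u => / (1 - u) ^ 2)).
      apply (is_RInt_derive (V := R_CompleteNormedModule) (fun u => / (1 - u)));
        rewrite Rmin_left, Rmax_right by lra; intros u Hu.
      + auto_derive; [lra | field; lra].
      + apply (ex_derive_continuous (V := R_NormedModule)); auto_derive; nra.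
    - apply (is_RInt_scal (V := R_NormedModule) (fun u => / (1 - u))).
      apply (is_RInt_derive (V := R_CompleteNormedModule) (fun u => - ln (1 - u)));
        rewrite Rmin_left, Rmax_right by lra; intros u Hu.
      + auto_derive; [lra | field; lra].
      + apply (ex_derive_continuous (V := R_NormedModule)); auto_derive; nra. }
  eapply Rle_trans; [refine (norm_RInt_le (V := R_NormedModule) _ _ _ _ _ _ _ _ I J); [lra|]|].
  2:{ rewrite Rminus_0_r, Rinv_1, ln_1; fold s.
    assert (Hs : 0 < s) by (unfold s; lra).
    pose proof (sqrt_bound_ln s Hs) as E.
    replace (M * s ^ 2 / y * (/ s - 1)) with (M * s * ((1 - s) / y)) by (field; lra).
    replace ((1 - s) / y) with 1 by (unfold s; field; lra).
    replace (M * s / y * (- ln s - - 0)) with (M * (/ y * (s * - ln s))) by (field; lra).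
    assert (/ y <= 2) by (rewrite <- (Rinv_inv 2); apply Rinv_le_contravar; lra).
    assert (0 < / y) by (apply Rinv_0_lt_compat; lra).
    pose proof (sqrt_pos s).
    assert (/ y * (s * - ln s) <= 4 * sqrt s) by nra.
    nra. }
  - intros u Hu; change (norm ?x) with (Rabs x).
    pose proof (kern_bound M u HM0 (HM u ltac:(lra)) ltac:(lra)) as Hk.
    (* Here [u / y - u = s / y - (s / y) (1 - u)] and [s / y = 1 / y - 1], while
       [0 <= ln y + 1 / y - 1 <= s^2 / y]. *)
    assert (Hc : Rabs (ln y + u / y - u) <= s ^ 2 / y + s / y * (1 - u)).
    { replace (ln y + u / y - u) with ((ln y + / y - 1) - s / y * (1 - u))
        by (unfold s; field; lra).
      pose proof (ln_ge_1_sub_inv y ltac:(lra)); pose proof (ln_le_sub_1 y ltac:(lra)).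
      assert (0 <= s / y * (1 - u)).
      { apply Rmult_le_pos; [apply Rdiv_le_0_compat; unfold s|]; lra. }
      replace (s ^ 2 / y) with (y - 1 + / y - 1) by (unfold s; field; lra).
      apply Rabs_le; lra. }
    rewrite Rabs_mult.
    replace (M * s ^ 2 / y * / (1 - u) ^ 2 + M * s / y * / (1 - u))
      with ((s ^ 2 / y + s / y * (1 - u)) * (M * / (1 - u) ^ 2)) by (field; lra).
    apply Rmult_le_compat; auto using Rabs_pos.
Qed.

Lemma filterlim_outer_prim_at_left_1 :
  filterlim outer_prim (at_left 1) (locally (RInt (fun u => log_weight u * m u) 0 1)).
Proof.
  destruct (bounded_continuous_01 m Hm) as [M [HM0 HM]].
  set (G (y : R) := RInt (fun u => log_weight u * m u) 0 y : R).
  apply (filterlim_ext (fun y => (outer_prim y - G y) + G y)); [intros y; ring|].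
  change (filterlim (fun y => outer_prim y - G y + G y) (at_left 1) (locally (G 1 : R_UniformSpace))).
  rewrite <- (Rplus_0_l (G 1)).
  apply (filterlim_comp_2 (G := locally 0) (H := locally (G 1)) _ _ Rplus);
    [| |apply (filterlim_plus (V := R_NormedModule) 0 (G 1))].
  - apply (filterlim_of_error _ _ (fun y => M * (1 - y) + 4 * M * sqrt (1 - y))).
    + generalize (at_left_interval (/ 2) 1 ltac:(lra)); apply filter_imp; intros y Hy.
      rewrite Rminus_0_r; apply outer_prim_error; assumption.
    + replace 0 with (M * (1 - 1) + 4 * M * sqrt (1 - 1))
        by (rewrite Rminus_diag, sqrt_0; ring).
      apply (filterlim_at_left_continuous (fun y => M * (1 - y) + 4 * M * sqrt (1 - y))).
      assert (Hs : continuous (fun y => 1 - y) 1).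
      { apply (ex_derive_continuous (V := R_NormedModule)); auto_derive; auto. }
      apply (continuous_plus (V := R_NormedModule) (fun y => M * (1 - y))).
      * apply (continuous_mult (K := R_AbsRing) (fun _ => M));
          [apply continuous_const | exact Hs].
      * apply (continuous_mult (K := R_AbsRing) (fun _ => 4 * M)); [apply continuous_const|].
        apply (continuous_comp (fun y => 1 - y) sqrt); [exact Hs | apply continuous_sqrt].
  - apply filterlim_RInt_at_left_1; intros x Hx.
    apply continuous_log_weight_mult; [exact Hx | apply Hm, Hx].
Qed.

Lemma double_integral :
  exists I : R -> R,
    (forall y, 0 < y < 1 ->
       is_RInt_gen (fun x => (1 - x) * kern m (x * y)) (at_right 0) (at_left 1) (I y)) /\
    is_RInt_gen I (at_right 0) (at_left 1) (RInt (fun u => log_weight u * m u) 0 1).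
Proof.
  exists inner; split; [exact inner_integral|].
  rewrite <- (Rminus_0_r (RInt _ _ _)).
  apply (is_RInt_gen_01_antiderivative _ outer_prim).
  - exact is_derive_outer_prim.
  - exact continuous_inner.
  - exact filterlim_outer_prim_at_right_0.
  - exact filterlim_outer_prim_at_left_1.
Qed.

End DoubleIntegral.

(** * Complex parameter *)

(** Componentwise, because every integral is handled through its real and imaginary parts. *)
Definition continuous_C (f : R -> C) (x : R) : Prop :=
  continuous (fun t => Re (f t)) x /\ continuous (fun t => Im (f t)) x.

Lemma continuous_C_RtoC (f : R -> R) (x : R) :
  continuous f x -> continuous_C (fun t => RtoC (f t)) x.
Proof. intros Hf; split; [exact Hf | apply continuous_const]. Qed.

Lemma continuous_C_mult (f g : R -> C) (x : R) :
  continuous_C f x -> continuous_C g x -> continuous_C (fun t => Cmult (f t) (g t)) x.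
Proof.
  intros [f1 f2] [g1 g2]; split.
  - apply (continuous_minus (V := R_NormedModule) (fun t => Re (f t) * Re (g t))
      (fun t => Im (f t) * Im (g t))); apply (continuous_mult (K := R_AbsRing)); assumption.
  - apply (continuous_plus (V := R_NormedModule) (fun t => Re (f t) * Im (g t))
      (fun t => Im (f t) * Re (g t))); apply (continuous_mult (K := R_AbsRing)); assumption.
Qed.

Definition lin_den (z : C) (x : R) : C := Cminus (RtoC 1) (Cmult (RtoC x) z).

Lemma Re_Im_sqr_pos (c : C) : c <> RtoC 0 -> 0 < Re c ^ 2 + Im c ^ 2.
Proof.
  intros Hc; pose proof (pow2_ge_0 (Re c)); pose proof (pow2_ge_0 (Im c)).
  apply Rnot_le_lt; intros E; apply Hc; destruct c as [a b]; simpl in *.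
  assert (a = 0) by nra; assert (b = 0) by nra; subst; reflexivity.
Qed.

Lemma continuous_C_inv_lin_den (z : C) (x : R) :
  lin_den z x <> RtoC 0 -> continuous_C (fun t => Cinv (lin_den z t)) x.
Proof.
  intros Hd; apply Re_Im_sqr_pos, Rgt_not_eq in Hd; destruct z as [a b].
  unfold lin_den, Cinv, Cminus, Cplus, Copp, Cmult, Re, Im, RtoC in *; simpl in *.
  split; apply (ex_derive_continuous (V := R_NormedModule)); simpl; auto_derive;
    exact Hd.
Qed.

Definition log_integral (f : R -> C) : C :=
  (RInt (fun x => log_weight x * Re (f x)) 0 1, RInt (fun x => log_weight x * Im (f x)) 0 1).

Lemma Re_RtoC_mult (r : R) (c : C) : Re (Cmult (RtoC r) c) = r * Re c.
Proof. unfold Re; simpl; ring. Qed.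

Lemma Im_RtoC_mult (r : R) (c : C) : Im (Cmult (RtoC r) c) = r * Im c.
Proof. unfold Im; simpl; ring. Qed.

Lemma is_RInt_log_integral (f : R -> C) :
  (forall x, 0 <= x <= 1 -> continuous_C f x) ->
  is_RInt (V := C_R_NormedModule) (fun x => Cmult (RtoC (log_weight x)) (f x)) 0 1
    (log_integral f).
Proof.
  intros Hf.
  apply (is_RInt_fct_extend_pair (U := R_NormedModule) (V := R_NormedModule)).
  - apply (is_RInt_ext (fun x => log_weight x * Re (f x)));
      [intros x _; symmetry; apply Re_RtoC_mult|].
    apply (RInt_correct (V := R_CompleteNormedModule)), ex_RInt_continuous_le; [lra|].
    intros x Hx; apply continuous_log_weight_mult; [exact Hx | apply Hf, Hx].
  - apply (is_RInt_ext (fun x => log_weight x * Im (f x)));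
      [intros x _; symmetry; apply Im_RtoC_mult|].
    apply (RInt_correct (V := R_CompleteNormedModule)), ex_RInt_continuous_le; [lra|].
    intros x Hx; apply continuous_log_weight_mult; [exact Hx | apply Hf, Hx].
Qed.

(** Integration takes place in [C] as a real module, whose scalars are real, so a complex factor is
    treated by components. *)
Lemma is_RInt_Cmult (f : R -> C) (a b : R) (c l : C) :
  is_RInt (V := C_R_NormedModule) f a b l ->
  is_RInt (V := C_R_NormedModule) (fun x => Cmult c (f x)) a b (Cmult c l).
Proof.
  intros Hf.
  pose proof (is_RInt_fct_extend_fst (U := R_NormedModule) (V := R_NormedModule) _ _ _ _ Hf) as H1.
  pose proof (is_RInt_fct_extend_snd (U := R_NormedModule) (V := R_NormedModule) _ _ _ _ Hf) as H2.
  apply (is_RInt_fct_extend_pair (U := R_NormedModule) (V := R_NormedModule)).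
  - apply (is_RInt_minus (V := R_NormedModule) (fun x => fst c * fst (f x))
      (fun x => snd c * snd (f x))); apply (is_RInt_scal (V := R_NormedModule)); assumption.
  - apply (is_RInt_plus (V := R_NormedModule) (fun x => fst c * snd (f x))
      (fun x => snd c * fst (f x))); apply (is_RInt_scal (V := R_NormedModule)); assumption.
Qed.

(** Turns the library estimates for the norm of an integral into estimates for the modulus. *)
Lemma norm_C_R (c : C) : norm (V := C_R_NormedModule) c = Cmod c.
Proof.
  unfold norm; simpl; unfold prod_norm, norm; simpl; unfold abs; simpl.
  unfold Cmod; f_equal; simpl; rewrite !Rmult_1_r, <- !Rabs_mult.
  f_equal; apply Rabs_pos_eq; nra.
Qed.

(* [(1 - x) / (1 - x z)], extended continuously to [x = 1] when [z = 1]. *)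
Definition moebius (z : C) (x : R) : C :=
  if Ceq_dec z (RtoC 1) then RtoC 1 else Cdiv (RtoC (1 - x)) (lin_den z x).

(** A zero means [x z = 1], so [z] is the real number [1 / x >= 1]; off the open ray this forces
    [z = 1] and [x = 1]. *)
Lemma lin_den_ne_0 (z : C) (x : R) :
  ~ on_open_ray z -> 0 <= x <= 1 -> z <> RtoC 1 \/ x < 1 -> lin_den z x <> RtoC 0.
Proof.
  intros Hz Hx Hzx E; destruct z as [a b].
  unfold on_open_ray, Re, Im in Hz; simpl in Hz.
  injection E; simpl; intros E2 E1.
  assert (x <> 0) by (intros ->; lra).
  assert (b = 0) by nra; subst b.
  assert (a <= 1) by (apply Rnot_lt_le; intros Ha; apply Hz; auto).
  assert (x = 1) by nra; subst x.
  assert (a = 1) by lra; subst a.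
  destruct Hzx as [Hzx | Hzx]; [apply Hzx; reflexivity | lra].
Qed.

Lemma moebius_lt_1 (z : C) (x : R) :
  ~ on_open_ray z -> 0 <= x < 1 -> moebius z x = Cdiv (RtoC (1 - x)) (lin_den z x).
Proof.
  intros Hz Hx; unfold moebius; destruct (Ceq_dec z (RtoC 1)) as [-> | _]; [|reflexivity].
  unfold lin_den; rewrite Cmult_1_r, <- RtoC_minus.
  unfold Cdiv; rewrite Cinv_r; [reflexivity|].
  intros E; injection E; lra.
Qed.

Lemma moebius_mult (z : C) (x : R) :
  ~ on_open_ray z -> 0 <= x <= 1 -> Cmult (moebius z x) (lin_den z x) = RtoC (1 - x).
Proof.
  intros Hz Hx; unfold moebius; destruct (Ceq_dec z (RtoC 1)) as [-> | Hz1].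
  - unfold lin_den; rewrite Cmult_1_r, Cmult_1_l, <- RtoC_minus; reflexivity.
  - pose proof (lin_den_ne_0 z x Hz Hx (or_introl Hz1)); field; assumption.
Qed.

Lemma continuous_C_moebius (z : C) (x : R) :
  ~ on_open_ray z -> 0 <= x <= 1 -> continuous_C (moebius z) x.
Proof.
  intros Hz Hx; unfold moebius; destruct (Ceq_dec z (RtoC 1)) as [-> | Hz1].
  - split; apply continuous_const.
  - apply (continuous_C_mult (fun x => RtoC (1 - x))).
    + apply continuous_C_RtoC, (ex_derive_continuous (V := R_NormedModule)); auto_derive; auto.
    + apply continuous_C_inv_lin_den, lin_den_ne_0; auto.
Qed.

(** * The two integral representations for complex [z] *)

Definition gamma_fun (z : C) : C := log_integral (moebius z).

Lemma RtoC_ne_0 (r : R) : r <> 0 -> RtoC r <> RtoC 0.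
Proof. intros Hr E; apply Hr; injection E; auto. Qed.

Lemma integrand_single_eq (z : C) (x : R) :
  ~ on_open_ray z -> 0 < x < 1 ->
  integrand_single z x = Cmult (RtoC (log_weight x)) (moebius z x).
Proof.
  intros Hz Hx; pose proof (ln_neg x Hx).
  rewrite moebius_lt_1, log_weight_lt_1 by (auto; lra).
  replace (/ ln x + / (1 - x)) with ((1 - x + ln x) * / (1 - x) * / ln x) by (field; lra).
  unfold integrand_single; fold (lin_den z x).
  pose proof (lin_den_ne_0 z x Hz ltac:(lra) (or_intror (proj2 Hx))).
  pose proof (RtoC_ne_0 (ln x) ltac:(lra)); pose proof (RtoC_ne_0 (1 - x) ltac:(lra)).
  rewrite !RtoC_mult, !RtoC_inv by lra; field; auto.
Qed.

(** Multiplying and dividing by [1 - u], with [u = x y], exhibits [(1 - x) * kern m u] for [m] the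
    real or imaginary part of [moebius z]. *)
Lemma integrand_double_eq (z : C) (x y : R) :
  ~ on_open_ray z -> 0 < x < 1 -> 0 < y < 1 ->
  integrand_double z x y =
  Cmult (RtoC ((1 - x) * (- / (1 - x * y) * / ln (x * y)))) (moebius z (x * y)).
Proof.
  intros Hz Hx Hy.
  assert (Hu : 0 < x * y < 1) by nra.
  unfold integrand_double; set (u := x * y) in *; pose proof (ln_neg u Hu).
  rewrite moebius_lt_1 by (auto; lra).
  replace ((1 - x) * (- / (1 - u) * / ln u)) with ((1 - x) * / (1 - u) * / - ln u)
    by (field; lra).
  fold (lin_den z u).
  pose proof (lin_den_ne_0 z u Hz ltac:(lra) (or_intror (proj2 Hu))).
  pose proof (RtoC_ne_0 (- ln u) ltac:(lra)); pose proof (RtoC_ne_0 (1 - u) ltac:(lra)).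
  rewrite !RtoC_mult, !RtoC_inv by lra; field; auto.
Qed.

Lemma single_integral_moebius (z : C) :
  ~ on_open_ray z -> is_int01 (integrand_single z) (gamma_fun z).
Proof.
  intros Hz; apply is_int01_pair.
  - apply (is_RInt_gen_01_ext (fun x => log_weight x * Re (moebius z x))).
    + intros x Hx; rewrite integrand_single_eq by assumption; symmetry; apply Re_RtoC_mult.
    + apply is_RInt_gen_01_continuous; intros x Hx.
      apply continuous_log_weight_mult; [exact Hx | apply continuous_C_moebius; assumption].
  - apply (is_RInt_gen_01_ext (fun x => log_weight x * Im (moebius z x))).
    + intros x Hx; rewrite integrand_single_eq by assumption; symmetry; apply Im_RtoC_mult.
    + apply is_RInt_gen_01_continuous; intros x Hx.
      apply continuous_log_weight_mult; [exact Hx | apply continuous_C_moebius; assumption].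
Qed.

Lemma double_integral_moebius (z : C) :
  ~ on_open_ray z -> is_int01_double (integrand_double z) (gamma_fun z).
Proof.
  intros Hz.
  destruct (double_integral (fun x => Re (moebius z x))) as [I1 [H1 J1]].
  { intros x Hx; apply continuous_C_moebius; assumption. }
  destruct (double_integral (fun x => Im (moebius z x))) as [I2 [H2 J2]].
  { intros x Hx; apply continuous_C_moebius; assumption. }
  exists (fun y => (I1 y, I2 y)); split.
  - intros y Hy; apply is_int01_pair.
    + generalize (H1 y Hy); apply is_RInt_gen_01_ext; intros x Hx.
      rewrite integrand_double_eq, Re_RtoC_mult by assumption; unfold kern, Rdiv; ring.
    + generalize (H2 y Hy); apply is_RInt_gen_01_ext; intros x Hx.
      rewrite integrand_double_eq, Im_RtoC_mult by assumption; unfold kern, Rdiv; ring.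
  - apply is_int01_pair; assumption.
Qed.

(** * The power series on the closed unit disc *)

Lemma not_on_open_ray_disc (z : C) : Cmod z <= 1 -> ~ on_open_ray z.
Proof.
  intros Hz [_ Hr]; pose proof (re_le_Cmod z); pose proof (Rle_abs (Re z)); lra.
Qed.

Lemma Cmod_lin_den_ge (z : C) (x : R) :
  Cmod z <= 1 -> 0 <= x <= 1 -> 1 - x <= Cmod (lin_den z x).
Proof.
  intros Hz Hx; unfold lin_den.
  pose proof (Cmod_triangle (Cminus (RtoC 1) (Cmult (RtoC x) z)) (Cmult (RtoC x) z)) as E.
  replace (Cplus (Cminus (RtoC 1) (Cmult (RtoC x) z)) (Cmult (RtoC x) z)) with (RtoC 1)
    in E by ring.
  rewrite Cmod_mult, !Cmod_R, Rabs_R1, (Rabs_pos_eq x) in E by lra.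
  pose proof (Cmod_ge_0 z); nra.
Qed.

Lemma Cmod_moebius_le_1 (z : C) (x : R) :
  Cmod z <= 1 -> 0 <= x <= 1 -> Cmod (moebius z x) <= 1.
Proof.
  intros Hz Hx; pose proof (not_on_open_ray_disc z Hz) as Hr.
  unfold moebius; destruct (Ceq_dec z (RtoC 1)) as [-> | Hz1].
  - rewrite Cmod_1; lra.
  - pose proof (lin_den_ne_0 z x Hr Hx (or_introl Hz1)) as Hd.
    pose proof (Cmod_lin_den_ge z x Hz Hx).
    rewrite Cmod_div, Cmod_R, Rabs_pos_eq by (auto; lra).
    apply Rle_div_l; [apply Cmod_gt_0, Hd | lra].
Qed.

(* The remainder of the series: since [moebius z x * (1 - x z) = 1 - x], each further term
   [z ^ n * (1 - x) * x ^ n] of the geometric series multiplies the integrand by [x z]. *)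
Lemma is_RInt_gamma_remainder (z : C) (n : nat) :
  Cmod z <= 1 ->
  is_RInt (V := C_R_NormedModule)
    (fun x => Cmult (RtoC (log_weight x * x ^ S n)) (Cmult (moebius z x) (pow_n z (S n)))) 0 1
    (Cminus (gamma_fun z) (sum_n (G := C_AbelianMonoid) (gamma_term z) n)).
Proof.
  intros Hz; pose proof (not_on_open_ray_disc z Hz) as Hr.
  assert (Hterm : forall k, is_RInt (V := C_R_NormedModule)
      (fun x => Cmult (pow_n z k) (RtoC (log_weight x * ((1 - x) * x ^ k)))) 0 1
      (gamma_term z k)).
  { intros k; apply is_RInt_Cmult.
    apply (is_RInt_fct_extend_pair (U := R_NormedModule) (V := R_NormedModule)).
    - rewrite <- (RInt_log_weight_pow k).
      apply (RInt_correct (V := R_CompleteNormedModule)), ex_RInt_continuous_le; [lra|].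
      intros x Hx; apply (continuous_log_weight_mult (fun x => (1 - x) * x ^ k)); [exact Hx|].
      apply (ex_derive_continuous (V := R_NormedModule)); auto_derive; auto.
    - pose proof (is_RInt_const (V := R_NormedModule) 0 1 0) as E.
      change (scal (1 - 0) 0) with ((1 - 0) * 0) in E; rewrite Rmult_0_r in E; exact E. }
  (* Subtracting the term of index [k] replaces [moebius z x] by [moebius z x * (1 - (1 - x z))].
     The bound variable [S] is the value of the integral and hides the successor. *)
  assert (Hstep : forall k S, is_RInt (V := C_R_NormedModule)
      (fun x => Cmult (RtoC (log_weight x * x ^ k)) (Cmult (moebius z x) (pow_n z k))) 0 1 S ->
      is_RInt (V := C_R_NormedModule)
      (fun x => Cmult (RtoC (log_weight x * x ^ Datatypes.S k))
        (Cmult (moebius z x) (pow_n z (Datatypes.S k)))) 0 1 (Cminus S (gamma_term z k))).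
  { intros k S HS.
    generalize (is_RInt_minus (V := C_R_NormedModule) _ _ _ _ _ _ HS (Hterm k)).
    apply is_RInt_ext; rewrite Rmin_left, Rmax_right by lra; intros x Hx.
    change (pow_n z (Datatypes.S k)) with (Cmult z (pow_n z k)).
    change (Cminus (Cmult (RtoC (log_weight x * x ^ k)) (Cmult (moebius z x) (pow_n z k)))
      (Cmult (pow_n z k) (RtoC (log_weight x * ((1 - x) * x ^ k)))) =
      Cmult (RtoC (log_weight x * (x * x ^ k))) (Cmult (moebius z x) (Cmult z (pow_n z k)))).
    rewrite !RtoC_mult, <- (moebius_mult z x) by (auto; lra).
    unfold lin_den; ring. }
  induction n as [|n IHn].
  (* [sum_n] up to index [0] already contains one term, so one step is taken from the full
     integral. *)
  - rewrite sum_O; apply Hstep.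
    generalize (is_RInt_log_integral (moebius z)
      (fun x Hx => continuous_C_moebius z x Hr Hx)).
    apply is_RInt_ext; intros x _.
    change (pow_n z 0) with (RtoC 1); simpl pow; rewrite Rmult_1_r, Cmult_1_r; reflexivity.
  - rewrite sum_Sn.
    replace (Cminus (gamma_fun z) (plus (sum_n (gamma_term z) n) (gamma_term z (S n))))
      with (Cminus (Cminus (gamma_fun z) (sum_n (G := C_AbelianMonoid) (gamma_term z) n))
             (gamma_term z (S n))).
    + apply Hstep, IHn.
    + change (plus ?a ?b) with (Cplus a b); ring.
Qed.

Lemma Cmod_pow_n_le_1 (z : C) (n : nat) : Cmod z <= 1 -> Cmod (pow_n (K := C_Ring) z n) <= 1.
Proof.
  intros Hz; induction n as [|n IHn].
  - change (Cmod (RtoC 1) <= 1); rewrite Cmod_1; lra.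
  - change (Cmod (Cmult z (pow_n (K := C_Ring) z n)) <= 1); rewrite Cmod_mult.
    pose proof (Cmod_ge_0 z); pose proof (Cmod_ge_0 (pow_n (K := C_Ring) z n)); nra.
Qed.

(** The weight, [moebius z x] and the power of [z] all have modulus at most [1], so [x^(n+1)]
    dominates the integrand. The bound is uniform up to the unit circle. *)
Lemma gamma_remainder_bound (z : C) (n : nat) :
  Cmod z <= 1 ->
  Cmod (Cminus (gamma_fun z) (sum_n (G := C_AbelianMonoid) (gamma_term z) n)) <= / INR (S (S n)).
Proof.
  intros Hz; rewrite <- norm_C_R.
  assert (P : 0 < INR (S (S n))) by (apply lt_0_INR; lia).
  assert (J : is_RInt (fun x => x ^ S n) 0 1 (/ INR (S (S n)))).
  { replace (/ INR (S (S n))) with (1 ^ S (S n) / INR (S (S n)) - 0 ^ S (S n) / INR (S (S n)))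
      by (rewrite pow1, pow_ne_zero by lia; field; lra).
    apply (is_RInt_derive (V := R_CompleteNormedModule) (fun x => x ^ S (S n) / INR (S (S n))));
      intros x _; [|apply continuous_pow].
    replace (x ^ S n) with (/ INR (S (S n)) * (INR (S (S n)) * x ^ S n)) by (field; lra).
    apply (is_derive_ext (fun t => / INR (S (S n)) * t ^ S (S n)));
      [intros t; apply Rmult_comm|].
    apply (is_derive_scal (fun t => t ^ S (S n))), is_derive_pow_S. }
  refine (norm_RInt_le (V := C_R_NormedModule) _ _ _ _ _ _ Rle_0_1 _
    (is_RInt_gamma_remainder z n Hz) J).
  intros x Hx; rewrite norm_C_R, !Cmod_mult, Cmod_R.
  pose proof (log_weight_01 x Hx); pose proof (pow_le x (S n) (proj1 Hx)).
  pose proof (Cmod_moebius_le_1 z x Hz Hx); pose proof (Cmod_pow_n_le_1 z (S n) Hz).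
  pose proof (Cmod_ge_0 (moebius z x)); pose proof (Cmod_ge_0 (pow_n (K := C_Ring) z (S n))).
  rewrite Rabs_pos_eq by (apply Rmult_le_pos; lra).
  assert (Cmod (moebius z x) * Cmod (pow_n (K := C_Ring) z (S n)) <= 1) by nra.
  assert (0 <= Cmod (moebius z x) * Cmod (pow_n (K := C_Ring) z (S n))) by nra.
  assert (log_weight x * x ^ S n <= x ^ S n) by nra.
  assert (0 <= log_weight x * x ^ S n) by nra.
  change (log_weight x * x ^ S n * (Cmod (moebius z x) * Cmod (pow_n (K := C_Ring) z (S n)))
    <= x ^ S n).
  nra.
Qed.

Lemma is_series_gamma_term (z : C) :
  Cmod z <= 1 ->
  is_series (K := C_AbsRing) (V := C_NormedModule) (gamma_term z) (gamma_fun z).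
Proof.
  intros Hz; apply (filterlim_locally_ball_norm (U := C_NormedModule)); intros eps.
  destruct (archimed_cor1 eps (cond_pos eps)) as [N [HN HN0]].
  exists N; intros n Hn.
  change (Cmod (Cminus (sum_n (G := C_AbelianMonoid) (gamma_term z) n) (gamma_fun z)) < eps).
  rewrite <- Cmod_opp.
  replace (Copp (Cminus (sum_n (G := C_AbelianMonoid) (gamma_term z) n) (gamma_fun z)))
    with (Cminus (gamma_fun z) (sum_n (G := C_AbelianMonoid) (gamma_term z) n)) by ring.
  apply Rle_lt_trans with (1 := gamma_remainder_bound z n Hz).
  apply Rle_lt_trans with (2 := HN), Rinv_le_contravar; [apply lt_0_INR, HN0|].
  apply le_INR; lia.
Qed.

(** * Differentiability *)

Lemma not_open_of_not_closed_ray (z : C) : ~ on_closed_ray z -> ~ on_open_ray z.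
Proof. intros Hz [H1 H2]; apply Hz; split; [exact H1 | lra]. Qed.

Lemma not_closed_ray_ne_1 (z : C) : ~ on_closed_ray z -> z <> RtoC 1.
Proof. intros Hz ->; apply Hz; split; simpl; lra. Qed.

(** A continuous function without zeros on the compact [[0, 1]] has a positive minimum modulus. *)
Lemma lin_den_lower_bound (z : C) :
  ~ on_closed_ray z -> exists c, 0 < c /\ forall x, 0 <= x <= 1 -> c <= Cmod (lin_den z x).
Proof.
  intros Hz.
  assert (Hd : forall x, 0 <= x <= 1 -> lin_den z x <> RtoC 0).
  { intros x Hx; apply lin_den_ne_0; auto using not_open_of_not_closed_ray, not_closed_ray_ne_1. }
  destruct (continuity_ab_min (fun x => Cmod (lin_den z x)) 0 1) as [c [Hc Hc01]]; [lra| |].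
  - intros x Hx; pose proof (Re_Im_sqr_pos _ (Hd x Hx)) as Hpos.
    apply continuity_pt_filterlim, (ex_derive_continuous (V := R_NormedModule)).
    destruct z as [a b]; unfold Cmod, lin_den, Cminus, Cplus, Copp, Cmult, RtoC, Re, Im in *;
      simpl in *; auto_derive.
    exact Hpos.
  - exists (Cmod (lin_den z c)); split; [apply Cmod_gt_0, Hd, Hc01 | exact Hc].
Qed.

Lemma lin_den_sub (z w : C) (x : R) :
  lin_den z x = Cplus (lin_den w x) (Cmult (RtoC x) (Cminus w z)).
Proof. unfold lin_den; ring. Qed.

Lemma Cmod_lin_den_near (z w : C) (x c : R) :
  0 <= x <= 1 -> c <= Cmod (lin_den z x) -> Cmod (Cminus w z) <= c / 2 ->
  c / 2 <= Cmod (lin_den w x).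
Proof.
  intros Hx Hc Hw; rewrite (lin_den_sub z w) in Hc.
  pose proof (Cmod_triangle (lin_den w x) (Cmult (RtoC x) (Cminus w z))) as E.
  rewrite Cmod_mult, Cmod_R, Rabs_pos_eq in E by lra.
  pose proof (Cmod_ge_0 (Cminus w z)); nra.
Qed.

Lemma Cmod_pos_ne_0 (c : C) : 0 < Cmod c -> c <> RtoC 0.
Proof. intros Hc ->; rewrite Cmod_0 in Hc; lra. Qed.

(** Used by contraposition: a point where the denominator stays away from [0] is off the ray. *)
Lemma lin_den_zero_on_ray (w : C) : on_closed_ray w -> exists x, 0 <= x <= 1 /\ lin_den w x = RtoC 0.
Proof.
  destruct w as [a b]; intros [Hb Ha]; simpl in *; subst b; exists (/ a).
  assert (0 < / a) by (apply Rinv_0_lt_compat; lra).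
  assert (/ a <= / 1) by (apply Rinv_le_contravar; lra).
  split; [lra|].
  unfold lin_den, Cminus, Cplus, Copp, Cmult, RtoC; simpl; f_equal; field; lra.
Qed.

Lemma moebius_off_ray (z : C) (x : R) :
  ~ on_closed_ray z -> moebius z x = Cmult (RtoC (1 - x)) (Cinv (lin_den z x)).
Proof.
  intros Hz; unfold moebius; destruct (Ceq_dec z (RtoC 1)) as [E | _]; [|reflexivity].
  exfalso; exact (not_closed_ray_ne_1 z Hz E).
Qed.

Definition moebius_deriv (z : C) (x : R) : C :=
  Cmult (RtoC (x * (1 - x))) (Cmult (Cinv (lin_den z x)) (Cinv (lin_den z x))).

Lemma continuous_C_moebius_deriv (z : C) (x : R) :
  ~ on_closed_ray z -> 0 <= x <= 1 -> continuous_C (moebius_deriv z) x.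
Proof.
  intros Hz Hx.
  assert (Hinv : continuous_C (fun t => Cinv (lin_den z t)) x).
  { apply continuous_C_inv_lin_den, lin_den_ne_0;
      auto using not_open_of_not_closed_ray, not_closed_ray_ne_1. }
  apply (continuous_C_mult (fun x => RtoC (x * (1 - x))));
    [|apply continuous_C_mult; exact Hinv].
  apply (continuous_C_RtoC (fun x => x * (1 - x))), (ex_derive_continuous (V := R_NormedModule)).
  auto_derive; auto.
Qed.

(** With [a = 1 - x z], [b = 1 - x w] and [d = w - z], one has [a - b = x d], hence [1/b - 1/a - x d
    / a^2 = x^2 d^2 / (b a^2)]. *)
Lemma moebius_expansion (z w : C) (x : R) :
  ~ on_closed_ray z -> ~ on_closed_ray w -> 0 <= x <= 1 ->
  Cminus (Cminus (moebius w x) (moebius z x)) (Cmult (Cminus w z) (moebius_deriv z x)) =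
  Cmult (RtoC (x ^ 2 * (1 - x)))
    (Cdiv (Cmult (Cminus w z) (Cminus w z))
      (Cmult (lin_den w x) (Cmult (lin_den z x) (lin_den z x)))).
Proof.
  intros Hz Hw Hx; rewrite !moebius_off_ray by assumption; unfold moebius_deriv.
  pose proof (lin_den_ne_0 z x (not_open_of_not_closed_ray z Hz) Hx
    (or_introl (not_closed_ray_ne_1 z Hz))) as Dz.
  pose proof (lin_den_ne_0 w x (not_open_of_not_closed_ray w Hw) Hx
    (or_introl (not_closed_ray_ne_1 w Hw))) as Dw.
  replace (x ^ 2) with (x * x) by ring.
  rewrite !RtoC_mult; unfold lin_den in *; field; auto.
Qed.

Lemma gamma_fun_expansion (z : C) :
  ~ on_closed_ray z ->
  exists c K, 0 < c /\ 0 < K /\ forall w, Cmod (Cminus w z) <= c ->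
    Cmod (Cminus (Cminus (gamma_fun w) (gamma_fun z))
      (Cmult (Cminus w z) (log_integral (moebius_deriv z)))) <= K * Cmod (Cminus w z) ^ 2.
Proof.
  intros Hz; destruct (lin_den_lower_bound z Hz) as [c [Hc0 Hc]].
  (* Within distance [c / 2] of [z] the denominator at [w] is at least [c / 2]; the remainder
     contains it once and the denominator at [z], at least [c], twice. *)
  exists (c / 2), (/ (c / 2 * (c * c))).
  assert (HK : 0 < c / 2 * (c * c)) by (repeat apply Rmult_lt_0_compat; lra).
  split; [lra|]; split; [apply Rinv_0_lt_compat, HK|]; intros w Hw.
  assert (Hdw : forall x, 0 <= x <= 1 -> c / 2 <= Cmod (lin_den w x)).
  { intros x Hx; apply (Cmod_lin_den_near z); auto. }
  assert (Hwr : ~ on_closed_ray w).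
  { intros Hr; destruct (lin_den_zero_on_ray w Hr) as [x [Hx E]].
    pose proof (Hdw x Hx) as H; rewrite E, Cmod_0 in H; lra. }
  pose proof (is_RInt_log_integral (moebius w) (fun x Hx =>
    continuous_C_moebius w x (not_open_of_not_closed_ray w Hwr) Hx)) as Iw.
  pose proof (is_RInt_log_integral (moebius z) (fun x Hx =>
    continuous_C_moebius z x (not_open_of_not_closed_ray z Hz) Hx)) as Iz.
  pose proof (is_RInt_log_integral (moebius_deriv z) (fun x Hx =>
    continuous_C_moebius_deriv z x Hz Hx)) as Id.
  pose proof (is_RInt_minus (V := C_R_NormedModule) _ _ _ _ _ _
    (is_RInt_minus (V := C_R_NormedModule) _ _ _ _ _ _ Iw Iz)
    (is_RInt_Cmult _ _ _ (Cminus w z) _ Id)) as I.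
  rewrite <- norm_C_R.
  replace (/ (c / 2 * (c * c)) * Cmod (Cminus w z) ^ 2)
    with ((1 - 0) * (Cmod (Cminus w z) ^ 2 / (c / 2 * (c * c)))) by (field; lra).
  refine (norm_RInt_le_const (V := C_R_NormedModule) _ _ _ _ _ Rle_0_1 _ I).
  intros x Hx; rewrite norm_C_R.
  change (Cmod (Cminus
    (Cminus (Cmult (RtoC (log_weight x)) (moebius w x))
            (Cmult (RtoC (log_weight x)) (moebius z x)))
    (Cmult (Cminus w z) (Cmult (RtoC (log_weight x)) (moebius_deriv z x))))
    <= Cmod (Cminus w z) ^ 2 / (c / 2 * (c * c))).
  replace (Cminus _ _) with (Cmult (RtoC (log_weight x))
    (Cminus (Cminus (moebius w x) (moebius z x)) (Cmult (Cminus w z) (moebius_deriv z x))))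
    by ring.
  rewrite moebius_expansion by assumption.
  set (den := Cmult (lin_den w x) (Cmult (lin_den z x) (lin_den z x))).
  assert (Hden : c / 2 * (c * c) <= Cmod den).
  { unfold den; rewrite !Cmod_mult; pose proof (Hdw x Hx); pose proof (Hc x Hx).
    repeat apply Rmult_le_compat; try apply Rmult_le_pos; lra. }
  rewrite !Cmod_mult, !Cmod_R, Cmod_div, Cmod_mult by (apply Cmod_pos_ne_0; lra).
  pose proof (log_weight_01 x Hx).
  assert (Hq : 0 <= x ^ 2 * (1 - x) <= 1) by (split; nra).
  rewrite !Rabs_pos_eq by lra.
  set (d := Cmod (Cminus w z)).
  assert (Hd : 0 <= d * d / Cmod den).
  { apply Rdiv_le_0_compat; [nra | lra]. }
  assert (d * d / Cmod den <= d ^ 2 / (c / 2 * (c * c))).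
  { replace (d ^ 2) with (d * d) by ring.
    apply Rmult_le_compat_l; [nra | apply Rinv_le_contravar; lra]. }
  assert (0 <= x ^ 2 * (1 - x) * (d * d / Cmod den) <= d * d / Cmod den) by (split; nra).
  nra.
Qed.

Lemma C_differentiable_gamma_fun (z : C) : ~ on_closed_ray z -> C_differentiable gamma_fun z.
Proof.
  intros Hz; destruct (gamma_fun_expansion z Hz) as [c [K [Hc [HK HE]]]].
  exists (log_integral (moebius_deriv z)); split; [apply is_linear_scal_l|].
  (* The differential is tested at every limit point of the neighbourhood filter of [z], and [z] is
     the only one. *)
  intros x Hx eps; apply (is_filter_lim_locally_unique (V := AbsRing_NormedModule C_AbsRing)) in Hx; subst x.
  (* The radius [eps / K] makes [K * |w - z|^2 <= eps * |w - z|]. *)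
  assert (Hr : 0 < Rmin c (eps / K)).
  { apply Rmin_glb_lt; [exact Hc | apply Rdiv_lt_0_compat; [apply cond_pos | exact HK]]. }
  exists (mkposreal _ Hr); intros w Hw.
  change (Cmod (Cminus w z) < Rmin c (eps / K)) in Hw.
  change (Cmod (Cminus (Cminus (gamma_fun w) (gamma_fun z))
    (Cmult (Cminus w z) (log_integral (moebius_deriv z)))) <= eps * Cmod (Cminus w z)).
  pose proof (Rmin_l c (eps / K)); pose proof (Rmin_r c (eps / K)).
  apply Rle_trans with (1 := HE w ltac:(lra)).
  assert (Hle : K * Cmod (Cminus w z) <= eps).
  { rewrite Rmult_comm; apply Rle_div_r; lra. }
  pose proof (Cmod_ge_0 (Cminus w z)); nra.
Qed.

Theorem theorem6 :
  exists F : C -> C,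
    (forall z : C, ~ on_open_ray z ->
        is_int01_double (integrand_double z) (F z) /\
        is_int01 (integrand_single z) (F z)) /\
    (forall z : C, Cmod z <= 1 ->
        is_series (K := C_AbsRing) (V := C_NormedModule) (gamma_term z) (F z)) /\
    (forall z : C, ~ on_closed_ray z -> C_differentiable F z).
Proof.
  exists gamma_fun; repeat split.
  - apply double_integral_moebius; assumption.
  - apply single_integral_moebius; assumption.
  - exact is_series_gamma_term.
  - exact C_differentiable_gamma_fun.
Qed.
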